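(* Let $(X,d)$ be a compact metric space supporting a $g$-Ahlfors regular measure $\mathcal H^g$, where $g$ is a doubling dimension function. Let $f$ be a dimension function such that $f\preceq g$. Assume that $\{B_n\}_{n\ge1}$ is a sequence of balls in $X$ with radii tending to $0$ and that $\mathcal H^g(\limsup_{n\to\infty} B_n)=\mathcal H^g(X)$. Let $\{E_n\}_{n\ge1}$ be a sequence of open sets with $E_n\subset B_n$, and assume there is a constant $c>0$ such that $\mathcal H^f_\infty(E_n)>c\,\mathcal H^g(B_n)$ for all $n\ge1$. Then $\limsup_{n\to\infty}E_n\in\mathscr G^f(X)$.
   Context: A dimension function is a continuous nondecreasing $f:\mathbb R^+\to\mathbb R^+$ with $f(0)=0$; it is doubling if there is $D>1$ with $f(2r)<Df(r)$ for all $r>0$. For $A\subset X$ and $0<\eta\le\infty$, $\mathcal H^f_\eta(A)=\inf\{\sum_i f(|B_i|): A\subset\bigcup_i B_i,\ B_i \text{ balls with } |B_i|\le\eta\}$; $\mathcal H^f=\lim_{\eta\to0}\mathcal H^f_\eta$ is the Hausdorff $f$-measure and $\mathcal H^f_\infty$ the Hausdorff $f$-content. $\mathcal H^g$ is $g$-Ahlfors regular if $\mathcal H^g(B(x,r))\asymp g(r)$ for all $x\in X$, $r>0$. $h\preceq f$ means $r\mapsto h(r)/f(r)$ is monotonic and $\lim_{r\to0}h(r)/f(r)>0$ (possibly infinite). $\limsup_n E_n=\bigcap_{N}\bigcup_{n\ge N}E_n$. $\mathscr G^f(X)$ is the class of $G_\delta$-subsets $A\subset X$ for which there is $c>0$ with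 $\mathcal H^f_\infty(A\cap B)>c\,\mathcal H^f_\infty(B)$ for every ball $B\subset X$. *)

(* Defs.v *)
From mathcomp Require Import all_boot all_order all_algebra.
From mathcomp Require Import all_classical all_reals all_analysis.
From mathcomp Require Import borel_hierarchy.

Set Implicit Arguments.
Unset Strict Implicit.
Unset Printing Implicit Defensive.

Import Order.TTheory GRing.Theory Num.Theory.
Import numFieldTopology.Exports numFieldNormedType.Exports.

Local Open Scope classical_set_scope.
Local Open Scope ring_scope.

(* A function on the half-line [0, +oo[ is represented by a function on [R];
   its values at negative arguments are irrelevant. *)
Definition dimension_function (R : realType) (f : R -> R) : Prop :=
  [/\ {within `[0, +oo[, continuous f},
      {in `[0, +oo[ &, {homo f : r s / r <= s}},
      (forall r, 0 <= r -> 0 <= f r) &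
      f 0 = 0].

Definition doubling (R : realType) (f : R -> R) : Prop :=
  exists2 D : R, 1 < D & forall r, 0 < r -> f (2 * r) < D * f r.

(* The order on dimension functions written h \preceq f; [l] may be [+oo]. *)
Definition dim_preceq (R : realType) (h f : R -> R) : Prop :=
  ({in `]0, +oo[ &, {homo (fun r => h r / f r) : r s / r <= s}} \/
   {in `]0, +oo[ &, {homo (fun r => h r / f r) : r s /~ r <= s}}) /\
  exists2 l : \bar R, (0 < l)%E & (h r / f r)%:E @[r --> 0^'+] --> l.

(* Only meaningful for bounded nonempty [A], such as a ball. *)
Definition diam (R : realType) (X : metricType R) (A : set X) : R :=
  sup [set mdist p.1 p.2 | p in A `*` A].

(* Coverings are countable families of open balls of positive radius; the index
   set [I] allows finite families. *)
Definition hausdorff_content (R : realType) (X : metricType R) (f : R -> R)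
    (eta : \bar R) (A : set X) : \bar R :=
  ereal_inf [set s | exists (I : set nat) (x : nat -> X) (r : nat -> R),
    [/\ forall i, I i -> 0 < r i,
        A `<=` \bigcup_(i in I) ball (x i) (r i),
        forall i, I i -> ((diam (ball (x i) (r i)))%:E <= eta)%E &
        s = \esum_(i in I) (f (diam (ball (x i) (r i))))%:E]].

Definition hausdorff_measure (R : realType) (X : metricType R) (f : R -> R)
    (A : set X) : \bar R :=
  lim (hausdorff_content f eta%:E A @[eta --> 0^'+]).

(* Radii are limited by the diameter of the space: in a bounded space the
   measure of [ball x r] stops growing there, so that without this limit an
   unbounded [g] such as a power function could never satisfy the condition. *)
Definition ahlfors_regular (R : realType) (X : metricType R) (g : R -> R) :
    Prop :=
  exists2 C : R, 0 < C & forall (x : X) (r : R), 0 < r <= diam [set: X] ->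
    ((C^-1 * g r)%:E <= hausdorff_measure g (ball x r) <= (C * g r)%:E)%E.

Definition large_intersection_class (R : realType) (X : metricType R)
    (f : R -> R) : set (set X) :=
  [set A | Gdelta A /\
    exists2 c : R, 0 < c & forall (x : X) (r : R), 0 < r ->
      (c%:E * hausdorff_content f +oo (ball x r) <
         hausdorff_content f +oo (A `&` ball x r))%E].

(* Main.v *)
Require Import Defs.
From mathcomp Require Import all_boot all_order all_algebra.
From mathcomp Require Import all_classical all_reals all_analysis.
From mathcomp Require Import finmap lra.

Import Order.TTheory GRing.Theory Num.Theory.
Import numFieldTopology.Exports numFieldNormedType.Exports.

Local Open Scope classical_set_scope.
Local Open Scope ring_scope.

Set Implicit Arguments.
Unset Strict Implicit.
Unset Printing Implicit Defensive.

(* Fix a cover of [limsup E_n] inside a ball by balls [V_i] and call a ball of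
   radius [rho] good if the [V_i] meeting it have total weight (the sum of the
   [f]-values of their radii) at most [eps * f rho].  If the content of the
   limsup in [B] is too small, then [B] is good for a suitable cover.

   Inside a good ball, the full measure of [limsup B_n] provides disjoint [B_n],
   as small as desired, that fill a fixed proportion of its [g]-mass.  As [f / g]
   is essentially decreasing, goodness bounds the [g]-mass of the [B_n] meeting
   some [V_i] larger than themselves, so a fixed proportion of the mass belongs
   to [B_n] which only meet smaller [V_i].  If the corresponding [E_n] contained
   no small good ball, then by Vitali covering the content of [E_n] would be at
   most a constant times the weight of the [V_i] meeting it; the sum of these
   weights is a tail of a convergent series, which contradicts the lower bound
   on the contents of the [E_n].

   Hence there is a nested sequence of good balls shrinking through infinitely
   many [E_n].  Its limit point is in [limsup E_n] but in no [V_i], since the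
   fixed weight of [V_i] would exceed the weight allowed in a small good ball. *)

(** * Covering lemmas *)

Lemma ball_mdist (R : realType) (X : metricType R) (z y : X) (t : R) :
  ball z t y <-> mdist z y < t.
Proof. by rewrite ballEmdist. Qed.

Lemma vitali_half_radius (R : realType) (X : metricType R) (I : Type)
    (V : set I) (y : I -> X) (t : I -> R) (M : R) :
  (forall i, V i -> 0 < t i <= M) ->
  exists D : set I, [/\ D `<=` V, trivIset D (fun i => ball (y i) (t i)) &
    forall i, V i -> exists j,
      [/\ D j, ball (y i) (t i) `&` ball (y j) (t j) !=set0 & t i <= 2 * t j]].
Proof.
move=> Vt.
pose B i := ball (y i) (t i).
have [D [[DV tD stD] maxD]] : exists D, [/\ D `<=` V, trivIset D B &
    forall i j, V i -> D j -> B i `&` B j !=set0 ->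
      exists k, [/\ D k, B i `&` B k !=set0 & t i <= 2 * t k]] /\
    forall E, D `<` E -> ~ [/\ E `<=` V, trivIset E B &
    forall i j, V i -> E j -> B i `&` B j !=set0 ->
      exists k, [/\ E k, B i `&` B k !=set0 & t i <= 2 * t k]].
  apply: (@Zorn_bigcup _ (fun D => [/\ D `<=` V, trivIset D B &
    forall i j, V i -> D j -> B i `&` B j !=set0 ->
      exists k, [/\ D k, B i `&` B k !=set0 & t i <= 2 * t k]])).
  move=> Fam FamP tot; split.
  - by move=> i [S /FamP[SV _ _] /SV].
  - move=> i j [S FS Si] [S' FS' S'j].
    have [/(_ _ Si) S'i|/(_ _ S'j) Sj] := tot _ _ FS FS'.
      by have [_ tS _] := FamP _ FS'; exact: tS.
    by have [_ tS _] := FamP _ FS; exact: tS.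
  - move=> i j Vi [S FS Sj] ij; have [_ _ /(_ i j Vi Sj ij)[k [Sk ? ?]]] := FamP _ FS.
    by exists k; split => //; exists S.
exists D; split => // i Vi.
have [[j [Dj ij]]|noD] := pselect (exists j, D j /\ B i `&` B j !=set0).
  by have [k [? ? ?]] := stD _ _ Vi Dj ij; exists k.
exfalso.
pose A := [set i | V i /\ forall j, D j -> ~ (B i `&` B j !=set0)].
have Ai : A i by split=> // j Dj ij; apply: noD; exists j.
have supA : has_sup (t @` A).
  split; first by exists (t i); exists i.
  by exists M => _ [j [Vj _] <-]; have /andP[] := Vt _ Vj.
have t0 := Vt _ Vi.
have sup0 : 0 < sup (t @` A).
  apply: (@lt_le_trans _ _ (t i)); first by case/andP: t0.
  by apply: ub_le_sup; [exact: supA.2|exists i].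
have [_ [m [Vm mD] <-] mt] : exists2 e, (t @` A) e & sup (t @` A) / 2 < e.
  have e0 : 0 < sup (t @` A) / 2 by rewrite divr_gt0.
  by have [e Ae] := sup_adherent e0 supA; exists e => //; lra.
apply: (maxD (D `|` [set m])).
  split; first exact: subsetUl.
  move=> /(_ m (or_intror erefl)) Dm; apply: (mD _ Dm).
  exists (y m); split; rewrite /B; apply: ballxx; by have /andP[] := Vt _ Vm.
split.
- by move=> j [/DV//|->].
- move=> j k [Dj|->] [Dk|->] // jk; first exact: tD.
    by case: (mD _ Dj); rewrite setIC.
  by case: (mD _ Dk).
- move=> k j Vk Dj kj.
  have [[l [Dl kl]]|nD] := pselect (exists l, D l /\ B k `&` B l !=set0).
    by have [p [? ? ?]] := stD _ _ Vk Dl kl; exists p; split => //; left.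
  case: Dj => [Dj|/= jm]; first by case: nD; exists j.
  rewrite {}jm in kj; exists m; split => //; first by right.
  have : t k <= sup (t @` A).
    apply: ub_le_sup; first exact: supA.2.
    by exists k => //; split => // l Dl kl; apply: nD; exists l.
  by lra.
Qed.

Lemma vitali_cover5 (R : realType) (X : metricType R) (I : Type)
    (V : set I) (y : I -> X) (t : I -> R) (M : R) :
  (forall i, V i -> 0 < t i <= M) ->
  exists D : set I, [/\ D `<=` V, trivIset D (fun i => ball (y i) (t i)) &
    \bigcup_(i in V) ball (y i) (t i) `<=`
      \bigcup_(i in D) ball (y i) (5 * t i)].
Proof.
move=> Vt; have [D [DV tD H]] := vitali_half_radius y Vt.
exists D; split => // p [i Vi ip].
have [j [Dj [q [iq jq]] ij]] := H _ Vi; exists j => //.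
move: ip iq jq; rewrite !ball_mdist => ip iq jq.
have := metric_triangle (y j) q p; have := metric_triangle q (y i) p.
by rewrite (metric_sym q (y i)); lra.
Qed.

Lemma esum_small_tail (R : realType) (I : set nat) (a t : nat -> R) (e : R) :
  (forall i, I i -> 0 < t i) -> (forall i, I i -> 0 <= a i) ->
  (\esum_(i in I) (a i)%:E < +oo)%E -> 0 < e ->
  exists2 tau : R, 0 < tau &
    (\esum_(i in [set i | I i /\ (t i < tau)%R]) (a i)%:E <= e%:E)%E.
Proof.
move=> t0 a0 fin e0.
have S0 : (0 <= \esum_(i in I) (a i)%:E)%E by apply: esum_ge0 => i /a0; rewrite lee_fin.
have Sfin : (\esum_(i in I) (a i)%:E)%E \is a fin_num by rewrite ge0_fin_numE.
have /ereal_sup_gt[_ [Y [finY YI] <-] YS] :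
    (\esum_(i in I) (a i)%:E - e%:E < \esum_(i in I) (a i)%:E)%E.
  by rewrite lteBlDr// lteDl// lte_fin.
have [tau tau0 tauY] : exists2 tau : R, 0 < tau & forall i, Y i -> tau <= t i.
  exists (\big[Num.min/1]_(i <- fset_set Y) t i).
    rewrite big_seq; elim/big_ind : _ => //.
      by move=> u v u0 v0; rewrite lt_min u0.
    by move=> i; rewrite in_fset_set// => /set_mem/YI/t0.
  move=> i Yi; apply: ge_bigmin_seq => //.
  by rewrite in_fset_set//; exact: mem_set.
exists tau => //.
have Esum : (\esum_(i in I) (a i)%:E = \esum_(i in I `&` Y) (a i)%:E +
    \esum_(i in I `&` ~` Y) (a i)%:E)%E.
  by apply: esumID => i /a0; rewrite lee_fin.
apply: (@le_trans _ _ (\esum_(i in I `&` ~` Y) (a i)%:E)%E).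
  apply: ereal_sup_le => _ [Z [finZ ZI] <-]; exists Z => //.
  split => // i /ZI[Ii it]; split => // Yi.
  by have := tauY _ Yi; rewrite leNgt it.
have leY : (\sum_(x \in Y) (a x)%:E <= \esum_(i in I `&` Y) (a i)%:E)%E.
  apply: esum_ge; exists Y => //.
  by split => // i Yi; split => //; exact: YI.
have Yfin : (\esum_(i in I `&` Y) (a i)%:E)%E \is a fin_num.
  rewrite ge0_fin_numE; last by apply: esum_ge0 => i [/a0]; rewrite lee_fin.
  apply: le_lt_trans fin; rewrite Esum leeDl//.
  by apply: esum_ge0 => i [/a0]; rewrite lee_fin.
rewrite -(leeD2lE _ _ Yfin) -Esum -leeBlDr//.
exact: (le_trans (ltW YS)).
Qed.

Lemma compact_finite_net (R : realType) (X : metricType R) (t : R) :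
  compact [set: X] -> 0 < t ->
  exists s : seq X, forall p, exists2 z, z \in s & mdist z p < t.
Proof.
move=> /compact_near_coveringP cX t0.
pose Fil : set_system (seq X) :=
  [set A | exists s0 : seq X, forall s : seq X, {subset s0 <= s} -> A s].
have FF : Filter Fil.
  split.
  - by exists [::].
  - move=> P Q [s1 H1] [s2 H2]; exists (s1 ++ s2) => s sub; split.
      by apply: H1 => z zs; apply: sub; rewrite mem_cat zs.
    by apply: H2 => z zs; apply: sub; rewrite mem_cat zs orbT.
  - by move=> P Q PQ [s1 H1]; exists s1 => s /H1 /PQ.
have [] := cX _ Fil (fun s p => exists2 z, z \in s & mdist z p < t) FF.
  move=> p _; exists (ball p t, [set s | p \in s]).
    split; first exact: nbhsx_ballx.
    by exists [:: p] => s; apply; rewrite mem_head.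
  by move=> [q s] /= [/ball_mdist pq ps]; exists p.
by move=> s0 /(_ s0 (fun _ h => h)) H; exists s0 => p; exact: (H p I).
Qed.

(** * Hausdorff contents and measures *)

Lemma diam_ge0 (R : realType) (X : metricType R) (A : set X) : 0 <= diam A.
Proof.
rewrite /diam; set S := [set _ | _ in _].
have [[[e [p Ap pe]] ubS]|/sup_out ->//] := pselect (has_sup S).
apply: le_trans (mdist_ge0 p.1 p.2) _.
by apply: ub_le_sup => //; exists p.
Qed.

Section content.
Variables (R : realType) (X : metricType R) (f : R -> R).
(* If [X] is empty, there are no covers and the content of the empty set is
   [+oo]. *)
Variable x0 : X.
Hypothesis f_ge0 : forall t, 0 <= t -> 0 <= f t.

Let fdiam_ge0 (A : set X) : (0 <= (f (diam A))%:E)%E.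
Proof. by rewrite lee_fin f_ge0// diam_ge0. Qed.

Lemma hausdorff_content_ge0 eta (A : set X) :
  (0 <= hausdorff_content f eta A)%E.
Proof.
by apply: le_ereal_inf_tmp => _ [I [y [t [_ _ _ ->]]]]; exact: esum_ge0.
Qed.

Lemma hausdorff_content_le eta (T : choiceType) (I : set T) (y : T -> X)
    (t : T -> R) (A : set X) : countable I -> (forall i, I i -> 0 < t i) ->
  A `<=` \bigcup_(i in I) ball (y i) (t i) ->
  (forall i, I i -> ((diam (ball (y i) (t i)))%:E <= eta)%E) ->
  (hausdorff_content f eta A <=
   \esum_(i in I) (f (diam (ball (y i) (t i))))%:E)%E.
Proof.
move=> /countable_injP[c cI] t0 AI dI; apply: ereal_inf_lbound.
have [[i0 Ii0]|noI] := pselect (exists i, I i); last first.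
  have -> : I = set0 by apply/seteqP; split => // i Ii; case: noI; exists i.
  have A0 : A = set0.
    by apply/seteqP; split => // p /AI[i Ii _]; case: noI; exists i.
  exists set0, (fun=> x0), (fun=> 1).
  by split; rewrite ?A0// !esum_set0.
pose d n := if pselect (exists i, I i /\ c i = n) is left h
  then projT1 (cid h) else i0.
have dE i : I i -> d (c i) = i.
  move=> Ii; rewrite /d; case: pselect => [h|[]]; last by exists i.
  case: (cid h) => j [Ij cji] /=; apply: cI => //; exact: mem_set.
exists (c @` I), (y \o d), (t \o d); split.
- by move=> _ [i Ii <-] /=; rewrite dE//; exact: t0.
- move=> p /AI[i Ii ip]; exists (c i); first by exists i.
  by rewrite /= dE.
- by move=> _ [i Ii <-] /=; rewrite dE//; exact: dI.
- rewrite esum_image; last by move=> i j; exact: cI.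
  by apply: eq_esum => i Ii /=; rewrite dE.
Qed.

Lemma hausdorff_content_subset eta (A B : set X) : A `<=` B ->
  (hausdorff_content f eta A <= hausdorff_content f eta B)%E.
Proof.
move=> AB; apply: ereal_inf_le_tmp => _ [I [y [t [t0 BI dI ->]]]].
by exists I, y, t; split => //; exact: subset_trans BI.
Qed.

Lemma hausdorff_content_anti eta eta' (A : set X) : (eta <= eta')%E ->
  (hausdorff_content f eta' A <= hausdorff_content f eta A)%E.
Proof.
move=> ee; apply: ereal_inf_le_tmp => _ [I [y [t [t0 BI dI ->]]]].
by exists I, y, t; split => // i /dI /le_trans; exact.
Qed.

Lemma hausdorff_content_bigcup eta (T : choiceType) (I : set T)
    (A : T -> set X) (a : T -> \bar R) : countable I ->
  (forall i, I i -> (hausdorff_content f eta (A i) < a i)%E) ->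
  (hausdorff_content f eta (\bigcup_(i in I) A i) <= \esum_(i in I) a i)%E.
Proof.
move=> cI Aa.
have H (i : T) : exists q : set nat * (nat -> X) * (nat -> R), I i ->
    [/\ forall n, q.1.1 n -> 0 < q.2 n,
        A i `<=` \bigcup_(n in q.1.1) ball (q.1.2 n) (q.2 n),
        forall n, q.1.1 n -> ((diam (ball (q.1.2 n) (q.2 n)))%:E <= eta)%E &
        (\esum_(n in q.1.1) (f (diam (ball (q.1.2 n) (q.2 n))))%:E <= a i)%E].
  have [Ii|nIi] := pselect (I i).
    have /ereal_inf_lt[_ [J [y [t [t0 AJ dJ ->]]]] /ltW le_a] := Aa _ Ii.
    by exists (J, y, t).
  by exists (set0, fun=> x0, fun=> 0).
have [q Hq] := choice H.
apply: (@le_trans _ _ (\esum_(k in I `*`` (fun i => (q i).1.1))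
    (f (diam (ball ((q k.1).1.2 k.2) ((q k.1).2 k.2))))%:E)%E).
  apply: (@hausdorff_content_le _ (T * nat)%type _
    (fun k => (q k.1).1.2 k.2) (fun k => (q k.1).2 k.2)).
  - have /countable_injP[c cI'] := cI; apply/countable_injP.
    exists (fun k => choice.pickle (c k.1, k.2)).
    move=> [i n] [j m] /set_mem[/= Ii _] /set_mem[/= Ij _].
    move/(pcan_inj choice.pickleK) => [cij ->]; congr (_, _).
    by apply: cI' => //; exact: mem_set.
  - by move=> [i n] /= [Ii qn]; have [+ _ _ _] := Hq i Ii; exact.
  - move=> p [i Ii Aip]; have [_ + _ _] := Hq i Ii.
    by move=> /(_ _ Aip)[n qn pn]; exists (i, n).
  - by move=> [i n] /= [Ii qn]; have [_ _ + _] := Hq i Ii; exact.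
rewrite -(@esum_esum _ _ _ I (fun i => (q i).1.1)
  (fun i n => (f (diam (ball ((q i).1.2 n) ((q i).2 n))))%:E))//.
by apply: le_esum => i Ii; have [] := Hq i Ii.
Qed.

Lemma hausdorff_content_setU eta (A B : set X) :
  (hausdorff_content f eta (A `|` B) <=
   hausdorff_content f eta A + hausdorff_content f eta B)%E.
Proof.
have := hausdorff_content_ge0 eta A; have := hausdorff_content_ge0 eta B.
have [->|Aoo] := eqVneq (hausdorff_content f eta A) +oo%E.
  by move=> B0 _; rewrite addye ?leey// gt_eqF// (lt_le_trans _ B0).
have [->|Boo] := eqVneq (hausdorff_content f eta B) +oo%E.
  by move=> _ A0; rewrite addey ?leey// gt_eqF// (lt_le_trans _ A0).
move=> B0 A0.
have Afin : hausdorff_content f eta A \is a fin_num.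
  by rewrite ge0_fin_numE// ltey.
have Bfin : hausdorff_content f eta B \is a fin_num.
  by rewrite ge0_fin_numE// ltey.
apply/lee_addgt0Pr => e e0.
pose C (b : bool) := if b then A else B.
have -> : A `|` B = \bigcup_(b in [set: bool]) C b.
  apply/seteqP; split => [p [Ap|Bp]|p [[] _ ?]]; [|by exists false|by left|by right].
  by exists true.
apply: (le_trans (@hausdorff_content_bigcup eta bool setT C
  (fun b => hausdorff_content f eta (C b) + (e / 2)%:E)%E _ _)).
- exact: countableP.
- by move=> b _; rewrite lteDl ?lte_fin ?divr_gt0//; case: b.
rewrite (esumID [set true]); last first.
  by move=> b _; rewrite adde_ge0 ?hausdorff_content_ge0// lee_fin ltW ?divr_gt0.
rewrite !setTI (_ : ~` [set true] = [set false]); last first.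
  by apply/seteqP; split => -[] //= h; exfalso; exact: h.
have e2 : (0 <= (e / 2)%:E)%E by rewrite lee_fin ltW// divr_gt0.
rewrite esum_set1; last exact: adde_ge0.
rewrite esum_set1; last exact: adde_ge0.
by rewrite /= addeACA -EFinD -splitr.
Qed.

Lemma hausdorff_measureE (A : set X) :
  hausdorff_measure f A =
  ereal_sup [set hausdorff_content f eta%:E A | eta in `]0, +oo[%classic].
Proof.
apply/cvg_lim => //; apply: (@nonincreasing_at_right_cvge _ _ _ +oo%O) => //.
by move=> a b _ _ ab; apply: hausdorff_content_anti; rewrite lee_fin.
Qed.

Lemma hausdorff_content_le_measure eta (A : set X) : 0 < eta ->
  (hausdorff_content f eta%:E A <= hausdorff_measure f A)%E.
Proof.
move=> e0; rewrite hausdorff_measureE; apply: ereal_sup_ubound.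
by exists eta => //=; rewrite in_itv/= e0.
Qed.

Lemma hausdorff_measure_le (A : set X) M :
  (forall eta, 0 < eta -> (hausdorff_content f eta%:E A <= M)%E) ->
  (hausdorff_measure f A <= M)%E.
Proof.
move=> H; rewrite hausdorff_measureE; apply: ge_ereal_sup => _ [e /= + <-].
by rewrite in_itv/= andbT => /H.
Qed.

Lemma hausdorff_measure_ge0 (A : set X) : (0 <= hausdorff_measure f A)%E.
Proof.
apply: le_trans (hausdorff_content_le_measure A (@ltr01 R)).
exact: hausdorff_content_ge0.
Qed.

Lemma hausdorff_measure_subset (A B : set X) : A `<=` B ->
  (hausdorff_measure f A <= hausdorff_measure f B)%E.
Proof.
move=> AB; apply: hausdorff_measure_le => e e0.
apply: le_trans (hausdorff_content_le_measure _ e0).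
exact: hausdorff_content_subset.
Qed.

Lemma hausdorff_measure_bigcup (T : choiceType) (I : set T)
    (A : T -> set X) (a : T -> \bar R) : countable I ->
  (forall i, I i -> (hausdorff_measure f (A i) < a i)%E) ->
  (hausdorff_measure f (\bigcup_(i in I) A i) <= \esum_(i in I) a i)%E.
Proof.
move=> cI Aa; apply: hausdorff_measure_le => e e0.
apply: hausdorff_content_bigcup => // i Ii.
exact: le_lt_trans (hausdorff_content_le_measure _ e0) (Aa _ Ii).
Qed.

Lemma hausdorff_measure_setU (A B : set X) :
  (hausdorff_measure f (A `|` B) <=
   hausdorff_measure f A + hausdorff_measure f B)%E.
Proof.
apply: hausdorff_measure_le => e e0.
apply: le_trans (hausdorff_content_setU _ _ _) _.
by apply: leeD; exact: hausdorff_content_le_measure.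
Qed.
End content.

Lemma esum_subset (R : realType) (T : choiceType) (I J : set T)
    (a : T -> \bar R) : I `<=` J ->
  (\esum_(i in I) a i <= \esum_(i in J) a i)%E.
Proof.
move=> IJ; apply: ereal_sup_le => _ [Z [finZ ZI] <-]; exists Z => //.
by split => //; exact: subset_trans IJ.
Qed.

Section diam_ball.
Variables (R : realType) (X : metricType R).
Implicit Types (y p q : X) (t : R).

Lemma mdist_ball_lt y t p q : ball y t p -> ball y t q -> mdist p q < 2 * t.
Proof.
rewrite !ball_mdist => yp yq; have := metric_triangle p y q.
by rewrite (metric_sym p y); lra.
Qed.

Lemma mdist_le_diam_ball y t p q :
  ball y t p -> ball y t q -> mdist p q <= diam (ball y t).
Proof.
move=> yp yq; apply: ub_le_sup; last by exists (p, q).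
by exists (2 * t) => _ [[a b] [/= ya yb] <-]; exact: ltW (mdist_ball_lt ya yb).
Qed.

Lemma diam_ball_le y t : 0 < t -> diam (ball y t) <= 2 * t.
Proof.
move=> t0; apply: ge_sup.
  by exists (mdist y y), (y, y) => //; split; exact: ballxx.
by move=> _ [[a b] [/= ya yb] <-]; exact: ltW (mdist_ball_lt ya yb).
Qed.

End diam_ball.

Section separated.
Variables (R : realType) (X : metricType R) (f : R -> R).
Variable x0 : X.
Hypothesis f_ge0 : forall t, 0 <= t -> 0 <= f t.

Lemma hausdorff_content_separated (A B : set X) d eta : eta < d ->
  (forall a b, A a -> B b -> d <= mdist a b) ->
  (hausdorff_content f eta%:E A + hausdorff_content f eta%:E B <=
   hausdorff_content f eta%:E (A `|` B))%E.
Proof.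
move=> ed sep; apply: le_ereal_inf_tmp => _ [I [y [t [t0 ABI dI ->]]]].
pose J (S : set X) := [set i | I i /\ ball (y i) (t i) `&` S !=set0].
have le_J (S : set X) : S `<=` A `|` B -> (hausdorff_content f eta%:E S <=
    \esum_(i in J S) (f (diam (ball (y i) (t i))))%:E)%E.
  move=> SAB; apply: hausdorff_content_le => //.
  - exact: countableP.
  - by move=> i [/t0].
  - move=> p Sp; have [i Ii ip] := ABI _ (SAB _ Sp).
    by exists i => //; split => //; exists p.
  - by move=> i [/dI].
apply: (le_trans (leeD (le_J A _) (le_J B _))).
- by move=> p; left.
- by move=> p; right.
have f0 i : (0 <= (f (diam (ball (y i) (t i))))%:E)%E.
  by rewrite lee_fin f_ge0// diam_ge0.
rewrite (esumID (J A) I)//; apply: leeD; apply: esum_subset.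
- by move=> i [Ii iA]; split => //; split.
- move=> i [Ii [b [ib Bb]]]; split => // -[_ [a [ia Aa]]].
  have := mdist_le_diam_ball ia ib; have := sep _ _ Aa Bb; have := dI _ Ii.
  by rewrite lee_fin; lra.
Qed.

Lemma hausdorff_measure_separated (A B : set X) d : 0 < d ->
  (forall a b, A a -> B b -> d <= mdist a b) ->
  (hausdorff_measure f A + hausdorff_measure f B <=
   hausdorff_measure f (A `|` B))%E.
Proof.
move=> d0 sep; set M := hausdorff_measure f (A `|` B).
have [->|Moo] := eqVneq M +oo%E; first by rewrite leey.
have M0 : (0 <= M)%E by exact: hausdorff_measure_ge0.
have Mfin : M \is a fin_num by rewrite ge0_fin_numE// ltey.
have le_M (e e' : R) : 0 < e -> 0 < e' ->
    (hausdorff_content f e%:E A + hausdorff_content f e'%:E B <= M)%E.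
  move=> e0 e'0; pose m := Num.min (Num.min e e') (d / 2).
  have m0 : 0 < m by rewrite !lt_min e0 e'0 divr_gt0.
  apply: (@le_trans _ _ (hausdorff_content f m%:E A + hausdorff_content f m%:E B)%E).
    by apply: leeD; apply: hausdorff_content_anti;
      rewrite lee_fin !ge_min lexx ?orbT.
  apply: (le_trans (@hausdorff_content_separated A B d m _ sep)).
    by rewrite !gt_min; apply/orP; right; lra.
  exact: hausdorff_content_le_measure.
have Bfin e : 0 < e -> hausdorff_content f e%:E B \is a fin_num.
  move=> e0; rewrite ge0_fin_numE ?hausdorff_content_ge0//.
  apply: (@le_lt_trans _ _ M); last by rewrite ltey.
  apply: le_trans (le_M 1 e _ e0) => //.
  by rewrite leeDr// hausdorff_content_ge0.
have HA e : 0 < e -> (hausdorff_measure f A <= M - hausdorff_content f e%:E B)%E.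
  move=> e0; apply: hausdorff_measure_le => e' e'0.
  by rewrite leeBrDr ?Bfin//; exact: le_M.
have Afin : hausdorff_measure f A \is a fin_num.
  rewrite ge0_fin_numE ?hausdorff_measure_ge0//.
  apply: (le_lt_trans (HA 1 _)) => //.
  by rewrite ltey_eq fin_numB Mfin Bfin.
rewrite addeC -leeBrDr//; apply: hausdorff_measure_le => e e0.
by rewrite leeBrDr// addeC -leeBrDr ?Bfin//; exact: HA.
Qed.

Lemma hausdorff_measure_separated_seq (T : eqType) (s : seq T)
    (A : T -> set X) (d : T -> R) : uniq s -> (forall i, i \in s -> 0 < d i) ->
  (forall i j a b, i \in s -> j \in s -> i != j -> A i a -> A j b ->
    d i <= mdist a b) ->
  (\sum_(i <- s) hausdorff_measure f (A i) <=
   hausdorff_measure f (\bigcup_(i in [set` s]) A i))%E.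
Proof.
elim: s => [|i s IH]; first by rewrite big_nil hausdorff_measure_ge0.
move=> /= /andP[iNs us] d0 sep; rewrite big_cons.
have -> : \bigcup_(j in [set` i :: s]) A j = A i `|` \bigcup_(j in [set` s]) A j.
  apply/seteqP; split => [p [j /= +] Ajp|p [Aip|[j js Ajp]]].
  - rewrite inE => /orP[/eqP ji|js]; first by left; rewrite -ji.
    by right; exists j.
  - by exists i => //=; rewrite mem_head.
  - by exists j => //=; rewrite inE [j \in s]js orbT.
apply: le_trans (@hausdorff_measure_separated _ _ (d i) _ _).
- apply: leeD => //; apply: IH => //.
    by move=> j js; apply: d0; rewrite inE js orbT.
  by move=> j k a b js ks; apply: sep; rewrite inE ?js ?ks orbT.
- by apply: d0; rewrite mem_head.
- move=> a b Aia [j js Ajb]; apply: (sep i j) => //.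
  + by rewrite mem_head.
  + by rewrite inE [j \in s]js orbT.
  + by apply: contraNneq iNs => ->.
Qed.

End separated.

(** * Packing and filling by balls *)

Section regular.
Variables (R : realType) (X : metricType R) (g G : R -> R) (C D : R).
Hypothesis g_ge0 : forall t, 0 <= t -> 0 <= g t.
Hypothesis G_gt0 : forall t, 0 < t -> 0 < G t.
Hypothesis G_doubling : forall t : R, 0 < t -> G (2 * t) <= D * G t.
Hypothesis C_gt0 : 0 < C.
Hypothesis D_gt0 : 0 < D.
Hypothesis measure_ball_ge : forall (y : X) (t : R), 0 < t ->
  ((C^-1 * G t)%:E <= hausdorff_measure g (ball y t))%E.
Hypothesis measure_ball_le : forall (y : X) (t : R), 0 < t ->
  (hausdorff_measure g (ball y t) <= (C * G t)%:E)%E.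

Let G4 (t : R) : 0 < t -> G t <= D ^+ 2 * G (t / 4).
Proof.
move=> t0; have t4 : 0 < t / 4 by lra.
have := G_doubling t4; have t2 : 0 < 2 * (t / 4) by lra.
have := G_doubling t2; rewrite (_ : 2 * (2 * (t / 4)) = t); last by lra.
move=> /le_trans + h; apply; rewrite expr2 -mulrA ler_wpM2l// ltW//.
Qed.

(* Disjoint balls may touch, but their concentric quarters are at positive
   distance from each other, where the Hausdorff measure is superadditive. *)
Lemma packing (T : eqType) (s : seq T) (y : T -> X) (t : T -> R) (z : X) (r : R) :
  0 < r -> uniq s -> (forall i, i \in s -> 0 < t i) ->
  trivIset [set` s] (fun i => ball (y i) (t i)) ->
  (forall i, i \in s -> ball (y i) (t i) `<=` ball z r) ->
  \sum_(i <- s) G (t i) <= C ^+ 2 * D ^+ 2 * G r.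
Proof.
move=> r0 us t0 triv sub.
have sep i j a b : i \in s -> j \in s -> i != j -> ball (y i) (t i / 4) a ->
    ball (y j) (t j / 4) b -> t i / 2 <= mdist a b.
  move=> si js ij; rewrite !ball_mdist => ia jb.
  have ti := t0 _ si; have tj := t0 _ js.
  have yij : Num.max (t i) (t j) <= mdist (y i) (y j).
    rewrite leNgt; apply/negP => lt_ij; move/eqP: ij; apply.
    apply: triv => //; move: lt_ij; rewrite lt_max => /orP[ltij|ltij].
      by exists (y j); split; [exact/ball_mdist|exact: ballxx].
    exists (y i); split; [exact: ballxx|apply/ball_mdist].
    by rewrite metric_sym.
  move: yij; rewrite ge_max => /andP[].
  have := metric_triangle (y i) a (y j); have := metric_triangle a b (y j).
  by rewrite (metric_sym b (y j)); lra.
have key : (\sum_(i <- s) (C^-1 * G (t i / 4))%:E <= (C * G r)%:E)%E.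
  apply: (@le_trans _ _ (\sum_(i <- s) hausdorff_measure g (ball (y i) (t i / 4)))%E).
    rewrite big_seq [leRHS]big_seq; apply: lee_sum => i si.
    by apply: measure_ball_ge; have := t0 _ si; lra.
  apply: (le_trans (@hausdorff_measure_separated_seq _ _ _ z g_ge0 _ s _
    (fun i => t i / 2) us _ sep)).
    by move=> i /t0 ti; lra.
  apply: le_trans (measure_ball_le z r0); apply: hausdorff_measure_subset.
  move=> p [i /= si ip]; apply: (sub i si); apply: le_ball ip.
  by have := t0 _ si; lra.
have C0 : C != 0 by rewrite gt_eqF.
move: key; rewrite sumEFin lee_fin -mulr_sumr ler_pdivrMl// mulrA -expr2 => key.
apply: (@le_trans _ _ (D ^+ 2 * \sum_(i <- s) G (t i / 4))).
  rewrite mulr_sumr big_seq [leRHS]big_seq; apply: ler_sum => i si.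
  by apply: G4; exact: t0.
by rewrite (mulrC (C ^+ 2)) -(mulrA _ (C ^+ 2)) ler_wpM2l// exprn_ge0// ltW.
Qed.

Hypothesis measure_fin : (hausdorff_measure g [set: X] < +oo)%E.

(* Superadditivity is available on separated sets only, which costs half of the
   radius. *)
Lemma measure_full_ball (L : set X) (z : X) (r : R) : 0 < r ->
  hausdorff_measure g L = hausdorff_measure g [set: X] ->
  ((C^-1 * G (r / 2))%:E <= hausdorff_measure g (L `&` ball z r))%E.
Proof.
move=> r0 Lfull; set H := hausdorff_measure g.
have Hfin : H (~` ball z r) \is a fin_num.
  rewrite ge0_fin_numE ?hausdorff_measure_ge0//.
  by apply: le_lt_trans measure_fin; apply: hausdorff_measure_subset.
have r2 : 0 < r / 2 by lra.
apply: (le_trans (measure_ball_ge z r2)).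
rewrite -(leeD2rE _ _ Hfin).
apply: (@le_trans _ _ (H [set: X])).
  apply: (@le_trans _ _ (H (ball z (r / 2) `|` ~` ball z r))).
    apply: (hausdorff_measure_separated z g_ge0 r2) => a b /ball_mdist za zb.
    have : r <= mdist z b by rewrite leNgt; apply/negP => /ball_mdist.
    by have := metric_triangle z a b; lra.
  exact: hausdorff_measure_subset.
rewrite -[H setT]Lfull; apply: (@le_trans _ _ (H ((L `&` ball z r) `|` ~` ball z r))).
  apply: hausdorff_measure_subset => // p Lp.
  by have [zp|] := pselect (ball z r p); [left|right].
exact: hausdorff_measure_setU.
Qed.

Lemma filling (x : nat -> X) (r : nat -> R) :
  (forall n, 0 < r n) -> r n @[n --> \oo] --> 0 ->
  hausdorff_measure g (lim_sup_set (fun n => ball (x n) (r n))) =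
    hausdorff_measure g [set: X] ->
  exists2 kappa : R, 0 < kappa & forall (z : X) (t : R) N, 0 < t ->
    exists s : seq nat, [/\ uniq s,
      forall n, n \in s -> (N <= n)%N /\ ball (x n) (r n) `<=` ball z t,
      trivIset [set` s] (fun n => ball (x n) (3 * r n)) &
      kappa * G t <= \sum_(n <- s) G (r n)].
Proof.
move=> r0 rcvg full.
pose k := (C^-1 / D ^+ 2) / 2 / (2 * C * D ^+ 4).
have k0 : 0 < k by rewrite !(divr_gt0, mulr_gt0, invr_gt0, exprn_gt0).
exists k => // z t N t0.
have [N1 rN1] : exists N1, forall n, (N1 <= n)%N -> r n < t / 4.
  have t4 : 0 < t / 4 by lra.
  have [N1 _ H] := cvgr_lt _ rcvg _ t4.
  by exists N1 => n /H.
pose V := [set n | (maxn N N1 <= n)%N /\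
  ball (x n) (r n) `&` ball z (t / 2) !=set0].
have [n Vn|Dm [DV tD cov]] := @vitali_cover5 R X nat V x (fun n => 3 * r n) t.
  have /rN1 : (N1 <= n)%N by case: Vn => + _; rewrite geq_max => /andP[].
  by have := r0 n; lra.
pose L := lim_sup_set (fun n => ball (x n) (r n)).
have LD : L `&` ball z (t / 2) `<=` \bigcup_(n in Dm) ball (x n) (16 * r n).
  move=> p [/(_ (maxn N N1) Logic.I)[n /= Nn np] zp].
  have [|m Dmm mp] := cov p.
    exists n; first by split => //; exists p.
    by apply: le_ball np; have := r0 n; lra.
  by exists m => //; apply: le_ball mp; have := r0 m; lra.
have t2 : 0 < t / 2 by lra.
have lower := measure_full_ball z t2 full.
have upper : (hausdorff_measure g (L `&` ball z (t / 2)) <=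
    \esum_(n in Dm) (2 * C * D ^+ 4 * G (r n))%:E)%E.
  apply: le_trans (hausdorff_measure_subset g LD) _.
  apply: (hausdorff_measure_bigcup z) => // [|n Dn]; first exact: countableP.
  have rn := r0 n.
  apply: le_lt_trans (@measure_ball_le (x n) (16 * r n) _) _; first by lra.
  have : G (16 * r n) <= D ^+ 2 * (D ^+ 2 * G (r n)).
    have := @G4 (16 * r n); rewrite (_ : 16 * r n / 4 = 4 * r n); last by lra.
    move=> /(_ ltac:(lra)) /le_trans; apply.
    rewrite ler_wpM2l// ?exprn_ge0//; first exact: ltW.
    have := @G4 (4 * r n); rewrite (_ : 4 * r n / 4 = r n); last by lra.
    by apply; lra.
  rewrite mulrA -exprD => G16; rewrite lte_fin.
  apply: (@le_lt_trans _ _ (C * (D ^+ 4 * G (r n)))); first by rewrite ler_wpM2l// ltW.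
  have : 0 < C * (D ^+ 4 * G (r n)) by rewrite !mulr_gt0// ?exprn_gt0// G_gt0.
  by lra.
have C' : 0 < C^-1 by rewrite invr_gt0.
have G0 := G_gt0 t0.
have low : ((C^-1 / D ^+ 2 / 2 * G t)%:E <
    \esum_(n in Dm) (2 * C * D ^+ 4 * G (r n))%:E)%E.
  apply: lt_le_trans (le_trans lower upper); rewrite lte_fin.
  rewrite (_ : t / 2 / 2 = t / 4); last by lra.
  have := G4 t0; rewrite mulrC -ler_pdivrMr ?exprn_gt0// => le4.
  apply: (@lt_le_trans _ _ (C^-1 * (G t / D ^+ 2))); last by rewrite ler_wpM2l// ltW.
  have : 0 < C^-1 * (G t / D ^+ 2) by rewrite !mulr_gt0// invr_gt0 exprn_gt0.
  rewrite (_ : C^-1 / D ^+ 2 / 2 * G t = C^-1 * (G t / D ^+ 2) / 2); first by lra.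
  by rewrite mulrAC (mulrAC C^-1) mulrA.
have [_ [Y [finY YD] <-]] := ereal_sup_gt low.
rewrite fsbig_finite//= sumEFin lte_fin -mulr_sumr => big.
have memY n : (n \in fset_set Y) = (n \in Y) by rewrite in_fset_set.
exists (enum_fset (fset_set Y)); split.
- exact: fset_uniq.
- move=> n; rewrite memY => /set_mem/YD/DV[]; rewrite geq_max => /andP[Nn N1n].
  move=> [q [nq zq]].
  split => // p np; move: nq zq np; rewrite !ball_mdist => nq zq np.
  have := rN1 _ N1n; have := metric_triangle z q p; have := metric_triangle q (x n) p.
  by rewrite (metric_sym q (x n)); lra.
- apply: sub_trivIset tD => n /=; rewrite memY => /set_mem; exact: YD.
- have K0 : 0 < 2 * C * D ^+ 4 by rewrite !mulr_gt0// exprn_gt0.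
  by rewrite /k mulrAC ler_pdivrMr// ltW// [ltRHS]mulrC.
Qed.
End regular.

Lemma esum_ge_term (R : realType) (T : choiceType) (I : set T)
    (a : T -> \bar R) i : (forall j, I j -> (0 <= a j)%E) -> I i ->
  (a i <= \esum_(j in I) a j)%E.
Proof.
move=> a0 Ii; rewrite -[leLHS](@esum_set1 R)//; last exact: a0.
by apply: esum_subset => _ ->.
Qed.

Lemma le_esumZl (R : realType) (T : choiceType) (I : set T) (a : T -> \bar R)
    (k : R) : 0 <= k -> (forall i, I i -> (0 <= a i)%E) ->
  (\esum_(i in I) (k%:E * a i) <= k%:E * \esum_(i in I) a i)%E.
Proof.
move=> k0 a0; apply: ge_ereal_sup => _ [Z [finZ ZI] <-].
rewrite fsbig_finite//= big_seq -ge0_sume_distrr; last first.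
  move=> i; rewrite in_fset_set// => /set_mem /ZI; exact: a0.
rewrite lee_wpmul2l ?lee_fin//; apply: ereal_sup_ubound; exists Z => //.
by rewrite fsbig_finite//= big_seq.
Qed.

Lemma esum_esum_disjoint_le (R : realType) (S T : choiceType) (A : set S)
    (J : S -> set T) (I : set T) (a : T -> \bar R) :
  (forall i, I i -> (0 <= a i)%E) -> (forall s, A s -> J s `<=` I) ->
  trivIset A J ->
  (\esum_(s in A) \esum_(i in J s) a i <= \esum_(i in I) a i)%E.
Proof.
move=> a0 JI triv; rewrite (@esum_esum _ _ _ A J (fun _ i => a i)); last first.
  by move=> s i As Ji; apply: a0; exact: JI Ji.
rewrite -(esum_image (A `*`` J) snd a).
  by apply: esum_subset => _ [[s i] [/= As Ji] <-]; exact: JI Ji.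
move=> [s i] [s' i'] /set_mem[/= As Ji] /set_mem[/= As' Ji'] ii'.
rewrite -{}ii' in Ji' *; congr (_, _).
by apply: triv => //; exists i.
Qed.

(** * Weights of covers and good balls *)

Section cover.
Variables (R : realType) (X : metricType R) (f F : R -> R) (D : R).
Hypothesis f_ge0 : forall t : R, 0 <= t -> 0 <= f t.
Hypothesis F_gt0 : forall t : R, 0 < t -> 0 < F t.
Hypothesis F_mono : forall s t : R, 0 < s -> s <= t -> F s <= F t.
Hypothesis F_doubling : forall t : R, 0 < t -> F (2 * t) <= D * F t.
Hypothesis D_gt0 : 0 < D.
Hypothesis F_diam : forall (y : X) (t : R),
  0 < t -> f (diam (ball y t)) <= F (2 * t).

Let F_pow k t : 0 < t -> F (2 ^+ k * t) <= D ^+ k * F t.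
Proof.
move=> t0; elim: k => [|k IH]; first by rewrite !expr0 !mul1r.
rewrite !exprS -!mulrA; apply: le_trans (F_doubling _) _.
  by rewrite mulr_gt0// exprn_gt0.
by rewrite ler_wpM2l// ltW.
Qed.

Variables (I : set nat) (u : nat -> X) (t : nat -> R).
Hypothesis t_gt0 : forall i, I i -> 0 < t i.

Definition hits (A : set X) := [set i | I i /\ ball (u i) (t i) `&` A !=set0].

Definition load (A : set X) := (\esum_(i in hits A) (F (t i))%:E)%E.

Let F0 i : I i -> (0 <= (F (t i))%:E)%E.
Proof. by move=> /t_gt0 /F_gt0 /ltW; rewrite lee_fin. Qed.

Lemma content_le_load (x0 : X) (A : set X) (eps rho0 : R) : open A -> 0 < eps ->
  0 < rho0 ->
  (forall y rho, 0 < rho <= rho0 -> ball y (2 * rho) `<=` A ->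
    ((eps * F rho)%:E < load (ball y rho))%E) ->
  (hausdorff_content f +oo A <= (D ^+ 2 + D ^+ 5 / eps)%:E * load A)%E.
Proof.
move=> oA eps0 rho00 bad.
have D0 := ltW D_gt0.
have load0 (S : set X) : (0 <= load S)%E by apply: esum_ge0 => i [/F0].
pose near_big := \bigcup_(i in hits A) ball (u i) (2 * t i).
rewrite -{1}(setUIDK A near_big) EFinD ge0_muleDl ?lee_fin ?exprn_ge0//; last first.
  by rewrite divr_ge0// ?exprn_ge0// ltW.
apply: (le_trans (hausdorff_content_setU x0 f_ge0 _ _ _)); apply: leeD.
- apply: le_trans (@hausdorff_content_le _ _ f x0 _ _ (hits A) u
    (fun i => 2 * t i) _ _ _ _ _) _.
  + exact: countableP.
  + by move=> i [/t_gt0 ti _]; rewrite mulr_gt0.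
  + by move=> p [].
  + by move=> i _; rewrite leey.
  + apply: le_trans (le_esumZl _ _); [|exact: exprn_ge0|by move=> i [/F0]].
    apply: le_esum => i [/t_gt0 ti _]; rewrite lee_fin.
    apply: le_trans (F_diam _ _) _; first by rewrite mulr_gt0.
    by have := F_pow 2 ti; rewrite expr2 mulrA.
- set A2 := A `&` ~` near_big.
  have /choice[rho rhoP] y : exists rho : R, A2 y ->
      0 < rho <= rho0 /\ ball y (2 * rho) `<=` A.
    have [[Ay _]|] := pselect (A2 y); last by exists 0.
    have /nbhs_ballP[e /= e0 eA] := open_nbhs_nbhs (conj oA Ay).
    exists (Num.min rho0 (e / 2)) => _.
    have e2 : 0 < e / 2 by rewrite divr_gt0.
    split; first by rewrite lt_min rho00 e2 ge_min lexx.
    apply: subset_trans eA; apply: le_ball.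
    by rewrite -ler_pdivlMl// mulrC ge_min lexx orbT.
  have [y A2y|Dm [DmA triv cov]] := @vitali_cover5 R X X A2 id
      (fun y => 3 * rho y) (3 * rho0).
    by have [/andP[? ?] _] := rhoP _ A2y; rewrite mulr_gt0//= ler_pM2l.
  have small y i : A2 y -> hits (ball y (rho y)) i ->
      hits A i /\ ball (u i) (t i) `<=` ball y (3 * rho y).
    move=> A2y [Ii [q [iq yq]]]; have [/andP[r0 _] rA] := rhoP _ A2y.
    have mi : hits A i.
      split => //; exists q; split => //; apply: rA; apply: le_ball yq; lra.
    split => // p; have ti := t_gt0 Ii.
    have : t i < rho y.
      rewrite ltNge; apply/negP => le_ti; case: A2y => _; apply; exists i => //.
      move: iq yq; rewrite !ball_mdist; have := metric_triangle (u i) q y.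
      by rewrite (metric_sym q y); lra.
    move: iq yq; rewrite !ball_mdist.
    have := metric_triangle y q p; have := metric_triangle q (u i) p.
    by rewrite (metric_sym q (u i)); lra.
  have badDm y : Dm y -> ((eps * F (rho y))%:E < load (ball y (rho y)))%E.
    by move=> /DmA /rhoP[r0 rA]; exact: bad.
  have trivm : trivIset Dm (fun y => hits (ball y (rho y))).
    move=> y y' Dy Dy' [i [yi y'i]]; apply: triv => //; exists (u i).
    have ui : ball (u i) (t i) (u i) by apply: ballxx; apply: t_gt0; case: yi.
    by split; [apply: (small y i (DmA _ Dy) yi).2|
      apply: (small y' i (DmA _ Dy') y'i).2].
  have /choice[h hP] y : exists n, Dm y -> hits (ball y (rho y)) n.
    have [Dy|] := pselect (Dm y); last by exists 0%N.
    have [[i yi]|no] := pselect (hits (ball y (rho y)) !=set0); first by exists i.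
    exfalso; have := badDm _ Dy; rewrite /load.
    have -> : hits (ball y (rho y)) = set0.
      by apply/seteqP; split => // i yi; case: no; exists i.
    rewrite esum_set0 lte_fin ltNge; apply/negP/negPn; rewrite mulr_ge0 ?ltW//.
    by have [/andP[? _] _] := rhoP _ (DmA _ Dy); exact: F_gt0.
  apply: le_trans (@hausdorff_content_le _ _ f x0 _ _ Dm id
    (fun y => 5 * (3 * rho y)) _ _ _ _ _) _.
  + apply/countable_injP; exists h => y y' /set_mem Dy /set_mem Dy' hh.
    by apply: trivm => //; exists (h y); split; [|rewrite hh]; exact: hP.
  + by move=> y /DmA /rhoP[/andP[r0 _] _]; lra.
  + move=> p A2p; apply: cov; exists p => //; apply: ballxx.
    by have [/andP[r0 _] _] := rhoP _ A2p; lra.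
  + by move=> y _; rewrite leey.
  + apply: (@le_trans _ _ (\esum_(y in Dm) ((D ^+ 5 / eps)%:E * load (ball y (rho y))))%E).
      apply: le_esum => y Dy; have [/andP[r0 _] _] := rhoP _ (DmA _ Dy).
      apply: (@le_trans _ _ ((D ^+ 5 / eps)%:E * (eps * F (rho y))%:E)%E).
        rewrite -EFinM lee_fin [leRHS]mulrA divfK ?gt_eqF//.
        apply: le_trans (F_pow 5 r0); apply: le_trans (F_diam _ _) _; first by lra.
        by apply: F_mono; lra.
      apply: lee_wpmul2l; last exact: ltW (badDm _ Dy).
      by rewrite lee_fin divr_ge0// ?exprn_ge0// ltW.
    apply: (le_trans (le_esumZl _ _)) => //.
      by rewrite divr_ge0// ?exprn_ge0// ltW.
    apply: lee_wpmul2l; first by rewrite lee_fin divr_ge0// ?exprn_ge0// ltW.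
    apply: esum_esum_disjoint_le => //; first by move=> i [/F0].
    by move=> y /DmA A2y i /(small _ _ A2y)[].
Qed.
End cover.

Section transference.
Variables (R : realType) (X : metricType R) (f F G : R -> R) (D K C : R).
Variables (x : nat -> X) (r : nat -> R) (E : nat -> set X) (c kappa eps : R).
Hypothesis f_ge0 : forall t : R, 0 <= t -> 0 <= f t.
Hypothesis F_gt0 : forall t : R, 0 < t -> 0 < F t.
Hypothesis F_mono : forall s t : R, 0 < s -> s <= t -> F s <= F t.
Hypothesis F_doubling : forall t : R, 0 < t -> F (2 * t) <= D * F t.
Hypothesis D_gt0 : 0 < D.
Hypothesis F_diam : forall (y : X) (t : R),
  0 < t -> f (diam (ball y t)) <= F (2 * t).
Hypothesis G_gt0 : forall t : R, 0 < t -> 0 < G t.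
Hypothesis G_doubling : forall t : R, 0 < t -> G (2 * t) <= D * G t.
Hypothesis FG : forall s t : R, 0 < s -> s <= t -> F t * G s <= K * (F s * G t).
Hypothesis r_gt0 : forall n, 0 < r n.
Hypothesis r_cvg0 : r n @[n --> \oo] --> 0.
Hypothesis G_packing : forall (s : seq nat) (z : X) (t : R), 0 < t -> uniq s ->
  trivIset [set` s] (fun n => ball (x n) (r n)) ->
  (forall n, n \in s -> ball (x n) (r n) `<=` ball z t) ->
  \sum_(n <- s) G (r n) <= C * G t.
Hypothesis G_filling : forall (z : X) (t : R) N, 0 < t ->
  exists s : seq nat, [/\ uniq s,
    forall n, n \in s -> (N <= n)%N /\ ball (x n) (r n) `<=` ball z t,
    trivIset [set` s] (fun n => ball (x n) (3 * r n)) &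
    kappa * G t <= \sum_(n <- s) G (r n)].
Hypothesis E_open : forall n, open (E n).
Hypothesis E_sub : forall n, E n `<=` ball (x n) (r n).
Hypothesis E_content : forall n,
  ((c * G (r n))%:E <= hausdorff_content f +oo (E n))%E.
Hypothesis c_gt0 : 0 < c.
Hypothesis kappa_gt0 : 0 < kappa.
Hypothesis K_gt0 : 0 < K.
Hypothesis C_gt0 : 0 < C.
Hypothesis eps_gt0 : 0 < eps.
Hypothesis eps_lt1 : eps < 1.
Hypothesis eps_small : C * D ^+ 2 * K * eps <= kappa / 2.

Variables (I : set nat) (u : nat -> X) (t : nat -> R).
Hypothesis t_gt0 : forall i, I i -> 0 < t i.
Hypothesis cover_fin : (\esum_(i in I) (F (t i))%:E < +oo)%E.

Let hits := hits I u t.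
Let load := load F I u t.

Let good (y : X) (rho : R) :=
  0 < rho /\ (load (ball y rho) <= (eps * F rho)%:E)%E.

Let F0 i : I i -> (0 <= (F (t i))%:E)%E.
Proof. by move=> /t_gt0 /F_gt0 /ltW; rewrite lee_fin. Qed.

Let hits_term (A : set X) i : hits A i -> ((F (t i))%:E <= load A)%E.
Proof. by move=> mi; apply: esum_ge_term => // j [/F0]. Qed.

Let big_balls (z : X) (rho : R) (s : seq nat) : good z rho -> uniq s ->
  trivIset [set` s] (fun n => ball (x n) (r n)) ->
  (forall n, n \in s -> exists i,
     [/\ hits (ball z rho) i, hits (ball (x n) (r n)) i & r n <= t i]) ->
  \sum_(n <- s) G (r n) <= kappa / 2 * G rho.
Proof.
move=> [rho0 gz] us triv big.
pose Q i n := `[< hits (ball (x n) (r n)) i /\ r n <= t i >].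
have Grho := G_gt0 rho0; have Frho := F_gt0 rho0; have D0 := ltW D_gt0.
have Gr n : 0 < G (r n) by exact: G_gt0.
have FG' i : hits (ball z rho) i -> G (t i) <= K * G rho / F rho * F (t i).
  move=> mi; have ti : 0 < t i by apply: t_gt0; case: mi.
  have lt_F : F (t i) < F rho.
    have := le_trans (hits_term mi) gz; rewrite lee_fin => /le_lt_trans; apply.
    by rewrite gtr_pMl.
  have ti_rho : t i <= rho.
    rewrite leNgt; apply/negP => /ltW /(F_mono rho0).
    by rewrite leNgt lt_F.
  have := FG ti ti_rho.
  rewrite mulrAC ler_pdivlMr// mulrC => /le_trans; apply.
  by rewrite -mulrA (mulrC (F _)).
rewrite -lee_fin -sumEFin.
apply: (@le_trans _ _ (\sum_(n <- s) \esum_(i in hits (ball z rho))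
    (if Q i n then G (r n) else 0)%:E)%E).
  rewrite big_seq [leRHS]big_seq; apply: lee_sum => n /big[i [zi ni ri]].
  rewrite -[leLHS](_ : (if Q i n then G (r n) else 0)%:E = _); last first.
    by rewrite /Q asboolT.
  apply: (@esum_ge_term _ _ _ (fun i => (if Q i n then G (r n) else 0)%:E)) => //.
  by move=> j _; rewrite lee_fin; case: ifP => // _; exact: ltW.
rewrite -esum_sum; last first.
  by move=> i n _ _; rewrite lee_fin; case: ifP => // _; exact: ltW.
pose M := C * D ^+ 2 * (K * G rho / F rho).
apply: (@le_trans _ _ (\esum_(i in hits (ball z rho)) (M%:E * (F (t i))%:E))%E).
  apply: le_esum => i mi; have ti : 0 < t i by apply: t_gt0; case: mi.
  rewrite sumEFin -EFinM lee_fin -big_mkcond -big_filter.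
  apply: (@le_trans _ _ (C * G (4 * t i))).
    apply: (@G_packing _ (u i)); first by rewrite mulr_gt0.
    - exact: filter_uniq.
    - by apply: sub_trivIset triv => n /=; rewrite mem_filter => /andP[].
    - move=> n; rewrite mem_filter => /andP[/asboolP[[_ [p [ip np]]] rt] _] q nq.
      move: ip np nq; rewrite !ball_mdist => ip np nq.
      have := metric_triangle (u i) p q; have := metric_triangle p (x n) q.
      by rewrite (metric_sym p (x n)); lra.
  have G4 : G (4 * t i) <= D ^+ 2 * G (t i).
    have := G_doubling ti; rewrite -(ler_pM2l D_gt0) mulrA -expr2.
    apply: le_trans; rewrite (_ : 4 * t i = 2 * (2 * t i)); last by lra.
    by apply: G_doubling; rewrite mulr_gt0.
  rewrite /M -(mulrA _ (K * _ / _)) -(mulrA C) ler_pM2l//.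
  by rewrite (le_trans G4)// ler_wpM2l ?exprn_ge0// FG'.
have M0 : 0 <= M by rewrite !(divr_ge0, mulr_ge0, exprn_ge0)// ltW.
apply: (le_trans (le_esumZl M0 _)) => [i [/F0]//|].
apply: (le_trans (lee_wpmul2l _ gz)); first by rewrite lee_fin.
rewrite -EFinM lee_fin.
have -> : M * (eps * F rho) = C * D ^+ 2 * K * eps * G rho.
  rewrite /M (mulrC eps) (mulrA _ (F rho) eps) -(mulrA (C * _) _ (F rho)) divfK ?gt_eqF//.
  by move: (D ^+ 2) => D2; rewrite !mulrA [RHS]mulrAC.
by rewrite ler_pM2r.
Qed.

Lemma good_subball (z : X) (rho : R) N rho0 : good z rho -> 0 < rho0 ->
  exists n y rho', [/\ (N <= n)%N, E n `<=` ball z rho,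
    ball y (2 * rho') `<=` E n, good y rho' & rho' <= rho0].
Proof.
move=> gz rho00; have [rho_gt0 _] := gz; apply: contrapT => none.
have Grho := G_gt0 rho_gt0.
pose M := D ^+ 2 + D ^+ 5 / eps.
have M0 : 0 < M by rewrite addr_gt0 ?divr_gt0 ?exprn_gt0.
have esc n : (N <= n)%N -> E n `<=` ball z rho ->
    ((c * G (r n))%:E <= M%:E * load (E n))%E.
  move=> Nn Enz; apply: (le_trans (E_content n)).
  apply: (content_le_load f_ge0 F_gt0 F_mono F_doubling D_gt0 F_diam t_gt0 z
    (E_open n) eps_gt0 rho00).
  move=> y rho' /andP[rho'0 rho'le] yE; rewrite ltNge; apply/negP => gy.
  by apply: none; exists n, y, rho'.
pose delta := c * kappa / (4 * M) * G rho.
have delta0 : 0 < delta by rewrite !(divr_gt0, mulr_gt0).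
have [tau tau0 tail] := esum_small_tail t_gt0 (fun i Ii => F0 Ii) cover_fin delta0.
have [N1 rN1] : exists N1, forall n, (N1 <= n)%N -> r n < tau.
  have [N1 _ H] := cvgr_lt _ r_cvg0 _ tau0.
  by exists N1 => n /H.
have [s [us sN triv3 sG]] := G_filling z (maxn N N1) rho_gt0.
have triv : trivIset [set` s] (fun n => ball (x n) (r n)).
  move=> n m sn sm [p [np mp]]; apply: triv3 => //; exists p.
  by split; [apply: le_ball np; have := r_gt0 n|apply: le_ball mp; have := r_gt0 m]; lra.
pose P n := `[< exists i, hits (ball (x n) (r n)) i /\ r n <= t i >].
have lt_t n i : ~~ P n -> hits (ball (x n) (r n)) i -> t i < r n.
  move=> /asboolP nP mi; rewrite ltNge; apply/negP => rt; apply: nP.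
  by exists i.
move: sG; rewrite (bigID P)/= -[X in X + _]big_filter -[X in _ + X]big_filter.
set s1 := [seq n <- s | P n]; set s2 := [seq n <- s | ~~ P n] => sG.
have le1 : \sum_(n <- s1) G (r n) <= kappa / 2 * G rho.
  apply: (big_balls gz); first exact: filter_uniq.
  - by apply: sub_trivIset triv => n /=; rewrite mem_filter => /andP[].
  - move=> n; rewrite mem_filter => /andP[/asboolP[i [ni rt]] /sN[_ nz]].
    exists i; split => //; case: ni => Ii [p [ip np]].
    by split => //; exists p; split => //; exact: nz.
have s2P n : n \in s2 -> [/\ n \in s, ~~ P n, (N <= n)%N, r n < tau &
    ball (x n) (r n) `<=` ball z rho].
  rewrite mem_filter => /andP[nP ns]; have [] := sN _ ns.
  by rewrite geq_max => /andP[Nn N1n] nz; split => //; exact: rN1.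
have hitsE n i : hits (E n) i -> hits (ball (x n) (r n)) i.
  by move=> [Ii [p [ip /E_sub np]]]; split => //; exists p.
have le2 : c * \sum_(n <- s2) G (r n) <= M * delta.
  rewrite -lee_fin mulr_sumr -sumEFin.
  apply: (@le_trans _ _ (\sum_(n <- s2) (M%:E * load (E n)))%E).
    rewrite big_seq [leRHS]big_seq; apply: lee_sum => n /s2P[_ _ Nn _ nz].
    by apply: esc => //; exact: subset_trans nz.
  rewrite -ge0_sume_distrr; last by move=> n _; apply: esum_ge0 => i [/F0].
  rewrite EFinM; apply: lee_wpmul2l; first by rewrite lee_fin ltW.
  apply: le_trans tail.
  rewrite fsbig_seq ?filter_uniq// -esum_fset//; last first.
    by move=> n _; apply: esum_ge0 => i [/F0].
  apply: esum_esum_disjoint_le; first by move=> i [/F0].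
    move=> n /= /s2P[_ nP _ rtau _] i mi; split; first by case: mi.
    by apply: lt_trans rtau; apply: lt_t => //; exact: hitsE.
  move=> n m /= /s2P[ns nP _ _ _] /s2P[ms mP _ _ _] [i [/hitsE ni /hitsE mi]].
  have in3 k : ~~ P k -> hits (ball (x k) (r k)) i -> ball (x k) (3 * r k) (u i).
    move=> kP ki; have := lt_t _ _ kP ki; case: ki => _ [p [ip kp]].
    move: ip kp; rewrite !ball_mdist; have := metric_triangle (x k) p (u i).
    by rewrite (metric_sym p); have := r_gt0 k; lra.
  by apply: triv3 => //; exists (u i); split; exact: in3.
have : \sum_(n <- s2) G (r n) <= kappa / 4 * G rho.
  rewrite -(ler_pM2l c_gt0); apply: (le_trans le2).
  rewrite /delta invfM (mulrA (c * kappa)) mulrA (mulrC M) divfK ?gt_eqF//.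
  by rewrite -!mulrA.
have : 0 < kappa * G rho by rewrite mulr_gt0.
by lra.
Qed.
Hypothesis F_small : forall e : R, 0 < e -> exists2 d : R, 0 < d & F d < e.
Hypothesis X_compact : compact [set: X].

Lemma uncovered_point (z : X) (rho : R) : good z rho ->
  exists p, [/\ lim_sup_set E p, ball z rho p &
    forall i, I i -> ~ ball (u i) (t i) p].
Proof.
move=> gz.
have /choice[nxt nxtP] (q : nat * (X * R)) : exists q' : X * R,
    good q.2.1 q.2.2 -> [/\ exists n, [/\ (q.1 <= n)%N, E n `<=` ball q.2.1 q.2.2 &
      ball q'.1 (2 * q'.2) `<=` E n], good q'.1 q'.2 & F q'.2 < q.1.+1%:R^-1].
  case: q => k [y s] /=.
  have [gy|] := pselect (good y s); last by exists (y, s).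
  have k0 : 0 < k.+1%:R^-1 :> R by rewrite invr_gt0.
  have [d d0 Fd] := F_small k0.
  have [n [y' [s' [kn Ey yE gy' s'd]]]] := good_subball k gy d0.
  exists (y', s') => _; split => //; first by exists n.
  by apply: le_lt_trans Fd; apply: F_mono => //; case: gy'.
pose w := nat_rect (fun=> (X * R)%type) (z, rho) (fun k p => nxt (k, p)).
have wS k : w k.+1 = nxt (k, w k) by [].
have gw k : good (w k).1 (w k).2.
  by elim: k => [//|k /(nxtP (k, w k))[_ + _]]; rewrite wS.
have wE k : exists n, [/\ (k <= n)%N, E n `<=` ball (w k).1 (w k).2 &
    ball (w k.+1).1 (2 * (w k.+1).2) `<=` E n].
  by have [] := nxtP (k, w k) (gw k).
have wF k : F (w k.+1).2 < k.+1%:R^-1 by have [] := nxtP (k, w k) (gw k).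
have w_gt0 k : 0 < (w k).2 by have [] := gw k.
have w_sub k j : ball (w (k + j)%N).1 (w (k + j)%N).2 `<=` ball (w k).1 (w k).2.
  elim: j => [|j IH]; first by rewrite addn0.
  apply: subset_trans IH; rewrite addnS => p wp.
  have [n [_ Ew wE']] := wE (k + j)%N; apply: Ew; apply: wE'.
  by apply: le_ball wp; have := w_gt0 (k + j).+1; lra.
have [p [_ clp]] := X_compact
  (fmap_proper_filter (fun k => (w k).1) eventually_filter) filterT.
have freq e N : 0 < e -> exists2 k, (N <= k)%N & ball p e (w k).1.
  move=> e0; have [] := clp [set (w k).1 | k in [set k | (N <= k)%N]] (ball p e).
  - by exists N => // k /= Nk; exists k.
  - exact: nbhsx_ballx.
  - by move=> _ [[k /= Nk <-] pk]; exists k.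
have pw k : ball (w k).1 (2 * (w k).2) p.
  have [j kj] := freq _ k (w_gt0 k); rewrite -(subnKC kj).
  have : ball (w k).1 (w k).2 (w (k + (j - k))%N).1 by apply: w_sub; exact: ballxx.
  rewrite !ball_mdist (metric_sym p).
  by have := metric_triangle (w k).1 (w (k + (j - k))%N).1 p; lra.
exists p; split.
- by move=> k _; have [n [kn _ wEn]] := wE k; exists n => //; exact: wEn.
- by have [n [_ En wEn]] := wE 0%N; apply: En; exact: wEn.
move=> i Ii ip; have Fti := F_gt0 (t_gt0 Ii).
have [N _ HN] := near_infty_natSinv_lt (PosNum Fti).
have e0 : 0 < t i - mdist (u i) p by rewrite subr_gt0; exact/ball_mdist.
have [[//|k] Nk pk] := freq _ N.+1 e0.
have : ((F (t i))%:E <= (eps * F (w k.+1).2)%:E)%E.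
  have [_ gk] := gw k.+1; apply: le_trans gk; apply: hits_term; split => //.
  exists (w k.+1).1; split; last exact: ballxx.
  move: pk; rewrite !ball_mdist.
  by have := metric_triangle (u i) p (w k.+1).1; lra.
rewrite lee_fin => le_eps.
have lt_F : F (w k.+1).2 < F (t i) by apply: lt_trans (wF k) (HN k Nk).
have : eps * F (w k.+1).2 <= F (w k.+1).2 by rewrite ger_pMl ?F_gt0// ltW.
by lra.
Qed.
End transference.

(** * Dimension functions and Ahlfors regularity *)

Lemma compact_mdist_le_diam (R : realType) (X : metricType R) (p q : X) :
  compact [set: X] -> mdist p q <= diam [set: X].
Proof.
move=> cX; apply: ub_le_sup; last by exists (p, q).
have [s sP] := compact_finite_net cX (@ltr01 R).
pose M := 1 + \sum_(z <- s) mdist p z.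
have leM a : mdist p a <= M.
  have [z zs za] := sP a; apply: (le_trans (metric_triangle p z a)).
  have : mdist p z <= \sum_(w <- s) mdist p w.
    by rewrite (big_rem z)//= lerDl; apply: sumr_ge0 => *; exact: mdist_ge0.
  by rewrite /M; lra.
exists (2 * M) => _ [[a b] _ <-] /=.
have := metric_triangle a p b; rewrite (metric_sym a p).
by have := leM a; have := leM b; lra.
Qed.

Lemma doubling_gt0 (R : realType) (g : R -> R) : dimension_function g ->
  doubling g -> forall t : R, 0 < t -> 0 < g t.
Proof.
move=> [_ _ g0 _] [D D1 dbl] t t0.
have : 0 < D * g t by apply: le_lt_trans (dbl _ t0); apply: g0; lra.
by rewrite pmulr_rgt0//; lra.
Qed.

(* Both monotone cases give the same one-sided comparison: if [h / g] decreases
   then [K = 1], and if it increases it lies between a positive lower bound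
   and its value at [b]. *)
Lemma preceq_quasi_decreasing (R : realType) (h g : R -> R) (b : R) :
  dimension_function h -> (forall t : R, 0 < t -> 0 < g t) -> dim_preceq h g ->
  0 < b ->
  (forall t : R, 0 < t -> 0 < h t) /\
  exists2 K, 1 <= K & forall s t : R, 0 < s -> s <= t -> t <= b ->
    h t * g s <= K * (h s * g t).
Proof.
move=> [_ hmono _ _] g0 [mono [l l0 cvl]] b0.
have [a a0 al] : exists2 a : R, 0 < a & (a%:E < l)%E.
  case: l l0 {cvl} => [l|_|//]; last by exists 1 => //; rewrite ltry.
  by rewrite lte_fin => l0; exists (l / 2); rewrite ?lte_fin; lra.
have small (t : R) : 0 < t -> exists s, [/\ 0 < s, s < t & a < h s / g s].
  move=> t0.
  have nl : nbhs l [set y | (a%:E < y)%E].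
    by apply: open_nbhs_nbhs; split => //; exact: open_ereal_gt_ereal.
  have near0 : \forall s \near 0^'+, [/\ 0 < s, s < t & a < h s / g s].
    near=> s; split.
    - by near: s; exact: nbhs_right_gt.
    - by near: s; exact: nbhs_right_lt.
    - by rewrite -lte_fin; near: s; exact: (cvl _ nl).
  exact: (filter_ex near0).
have h0 t : 0 < t -> 0 < h t.
  move=> t0; have [s [s0 st as_]] := small _ t0.
  have hs : 0 < h s.
    have : 0 < h s / g s by exact: lt_trans as_.
    by rewrite pmulr_lgt0// invr_gt0 g0.
  by apply: (lt_le_trans hs); apply: hmono; rewrite ?in_itv/= ?andbT; lra.
split=> //.
have suffK K : (forall s t : R, 0 < s -> s <= t -> t <= b ->
    h t / g t <= K * (h s / g s)) -> forall s t : R, 0 < s -> s <= t -> t <= b ->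
    h t * g s <= K * (h s * g t).
  move=> H s t s0 st tb; have t0 : 0 < t := lt_le_trans s0 st.
  have := H _ _ s0 st tb; rewrite ler_pdivrMr ?g0// -(ler_pM2r (g0 _ s0)).
  move=> /le_trans; apply.
  by rewrite mulrAC mulrA divfK ?gt_eqF ?g0// mulrA.
have in0 (t : R) : 0 < t -> t \in `]0, +oo[ by rewrite in_itv/= andbT.
have [inc|dec] := mono.
- exists (Num.max 1 (h b / g b / a)); first by rewrite le_max lexx.
  apply: suffK => s t s0 st tb; have t0 : 0 < t := lt_le_trans s0 st.
  have [s' [s'0 /ltW s's as']] := small _ s0.
  have ls : a <= h s / g s := le_trans (ltW as') (inc _ _ (in0 _ s'0) (in0 _ s0) s's).
  apply: (le_trans (inc _ _ (in0 _ t0) (in0 _ b0) tb)).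
  have hb : 0 < h b / g b by rewrite divr_gt0 ?g0 ?h0.
  apply: (@le_trans _ _ (h b / g b / a * (h s / g s))).
    move: (h b / g b) (h s / g s) hb ls => qb qs hb ls.
    by rewrite -mulrA ler_peMr//; [exact: ltW|rewrite mulrC ler_pdivlMr// mul1r].
  by apply: ler_wpM2r; [rewrite ltW// divr_gt0 ?g0 ?h0|rewrite le_max lexx orbT].
- exists 1 => //; apply: suffK => s t s0 st tb; rewrite mul1r.
  by apply: dec => //; apply: in0 => //; exact: lt_le_trans st.
Unshelve. all: by end_near. Qed.

Section truncation.
Variables (R : realType) (X : metricType R).
Hypothesis X_compact : compact [set: X].
Let d := diam [set: X].

(* Since balls stop growing at radius [diam X], this makes the comparisons between
   [f], [g] and the measures of balls valid at every radius. *)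
Definition truncated (h : R -> R) (t : R) := h (Num.min t d).

Lemma diam_ball_le_diam (y : X) (t : R) : 0 < t -> diam (ball y t) <= d.
Proof.
move=> t0; apply: ge_sup.
  by exists (mdist y y), (y, y) => //; split; exact: ballxx.
by move=> _ [[a b] _ <-]; exact: compact_mdist_le_diam.
Qed.

Lemma truncated_diam_ball (h : R -> R) (y : X) (t : R) : dimension_function h ->
  0 < t -> h (diam (ball y t)) <= truncated h (2 * t).
Proof.
move=> [_ hmono _ _] t0.
have le_t : diam (ball y t) <= Num.min (2 * t) d.
  by rewrite le_min diam_ball_le ?diam_ball_le_diam.
have p0 := diam_ge0 (ball y t).
by apply: hmono => //; rewrite in_itv/= andbT// (le_trans p0).
Qed.

Hypothesis d_gt0 : 0 < d.
Let min_gt0 (t : R) : 0 < t -> 0 < Num.min t d.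
Proof. by move=> t0; rewrite lt_min t0. Qed.

Lemma truncated_gt0 (h : R -> R) : (forall t : R, 0 < t -> 0 < h t) ->
  forall t : R, 0 < t -> 0 < truncated h t.
Proof. by move=> h0 t t0; apply: h0; exact: min_gt0. Qed.

Lemma truncated_mono (h : R -> R) : dimension_function h ->
  forall s t : R, 0 < s -> s <= t -> truncated h s <= truncated h t.
Proof.
move=> [_ hmono _ _] s t s0 st; have t0 := lt_le_trans s0 st.
apply: hmono; rewrite ?in_itv/= ?andbT; [exact/ltW/min_gt0|exact/ltW/min_gt0|].
by rewrite le_min !ge_min st lexx orbT.
Qed.

Lemma truncated_doubling (g : R -> R) (D : R) : dimension_function g ->
  1 < D -> (forall t : R, 0 < t -> g (2 * t) < D * g t) ->
  forall t : R, 0 < t -> truncated g (2 * t) <= D * truncated g t.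
Proof.
move=> [_ gmono g0 _] D1 dbl t t0; rewrite /truncated.
have [td|dt] := leP t d; last first.
  rewrite min_r; last by lra.
  by rewrite ler_peMl//; [apply: g0; exact: ltW|exact: ltW].
apply: (le_trans _ (ltW (dbl _ t0))).
apply: gmono; rewrite ?in_itv/= ?andbT; last by rewrite ge_min lexx.
  by apply/ltW/min_gt0; rewrite mulr_gt0.
by lra.
Qed.

Lemma truncated_quasi_decreasing (h g : R -> R) (K : R) :
  (forall s t : R, 0 < s -> s <= t -> t <= d -> h t * g s <= K * (h s * g t)) ->
  forall s t : R, 0 < s -> s <= t ->
    truncated h t * truncated g s <= K * (truncated h s * truncated g t).
Proof.
move=> H s t s0 st; apply: H; first exact: min_gt0.
  by rewrite le_min !ge_min st lexx orbT.
by rewrite ge_min lexx orbT.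
Qed.

Lemma truncated_small (h : R -> R) : dimension_function h ->
  forall e : R, 0 < e -> exists2 s : R, 0 < s & truncated h s < e.
Proof.
move=> [/continuous_within_itvcyP[_ hr] _ _ h00] e e0.
have : \forall s \near 0^'+, [/\ 0 < s, s < d & h s < e].
  near=> s; split.
  - by near: s; exact: nbhs_right_gt.
  - by near: s; exact: nbhs_right_lt.
  - by near: s; apply: (cvgr_lt _ hr); rewrite h00.
move=> /filter_ex[s [s0 sd hs]]; exists s => //.
by rewrite /truncated min_l ?ltW.
Unshelve. all: by end_near. Qed.
End truncation.

Section ahlfors.
Variables (R : realType) (X : metricType R) (g : R -> R).
Hypothesis X_compact : compact [set: X].
Hypothesis g_dim : dimension_function g.
Hypothesis g_doubling : doubling g.
Hypothesis g_regular : ahlfors_regular X g.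
Let d := diam [set: X].
Hypothesis d_gt0 : 0 < d.

Let g_ge0 : forall t, 0 <= t -> 0 <= g t.
Proof. by have [] := g_dim. Qed.

Let g_gt0 := doubling_gt0 g_dim g_doubling.

Lemma hausdorff_measure_setT_fin (x0 : X) :
  (hausdorff_measure g [set: X] < +oo)%E.
Proof.
have [C C0 reg] := g_regular.
have [s sP] := compact_finite_net X_compact d_gt0.
have cover_s : [set: X] `<=` \bigcup_(z in [set` s]) ball z d.
  by move=> p _; have [z zs zp] := sP p; exists z => //; exact/ball_mdist.
apply: le_lt_trans (hausdorff_measure_subset g cover_s) _.
apply: (@le_lt_trans _ _ (\esum_(z in [set` s]) (C * g d + 1)%:E)%E).
  apply: (hausdorff_measure_bigcup x0 g_ge0) => [|z _].
    exact/finite_set_countable/finite_seq.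
  apply: (@le_lt_trans _ _ (C * g d)%:E); last by rewrite lte_fin ltrDl.
  by have /andP[] := reg z d ltac:(by rewrite d_gt0 lexx).
have fin_s : finite_set [set` s] by exact: finite_seq.
rewrite esum_fset//.
  by rewrite fsbig_finite//; apply: lte_sum_pinfty => z _; rewrite ltry.
by move=> z _; rewrite lee_fin addr_ge0 ?mulr_ge0 ?g_ge0// ltW.
Qed.

Lemma ahlfors_truncated (x0 : X) : exists2 C : R, 0 < C &
  forall (y : X) (t : R), 0 < t ->
    ((C^-1 * truncated X g t)%:E <= hausdorff_measure g (ball y t) <=
     (C * truncated X g t)%:E)%E.
Proof.
have [C C0 reg] := g_regular.
have gd := g_gt0 d_gt0.
have Hfin := hausdorff_measure_setT_fin x0.
have H0 := @hausdorff_measure_ge0 _ X _ g_ge0 setT.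
have HE : hausdorff_measure g [set: X] = (fine (hausdorff_measure g [set: X]))%:E.
  by rewrite fineK// ge0_fin_numE.
set M := fine _ in HE.
have M0 : 0 <= M by rewrite -lee_fin -HE.
exists (Num.max C (M / g d)); first by rewrite lt_max C0.
move=> y t t0.
have tr0 : 0 < truncated X g t by apply: truncated_gt0.
have invC : (Num.max C (M / g d))^-1 <= C^-1.
  by rewrite lef_pV2 ?posrE ?lt_max ?C0// le_max lexx.
have [td|dt] := leP t d.
  have trE : truncated X g t = g t by rewrite /truncated min_l.
  have /andP[lo up] := reg y t ltac:(by rewrite t0 td).
  rewrite trE in tr0 *; apply/andP; split.
    by apply: le_trans lo; rewrite lee_fin ler_pM2r.
  by apply: (le_trans up); rewrite lee_fin ler_pM2r// le_max lexx.
have trE : truncated X g t = g d by rewrite /truncated min_r// ltW.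
rewrite trE in tr0 *; apply/andP; split.
  have /andP[lo _] := reg y d ltac:(by rewrite d_gt0 lexx).
  apply: le_trans (hausdorff_measure_subset g (le_ball (ltW dt))).
  by apply: le_trans lo; rewrite lee_fin ler_pM2r.
apply: (le_trans (hausdorff_measure_subset g (@subsetT _ _))).
by rewrite HE lee_fin -ler_pdivrMr// le_max lexx orbT.
Qed.

Lemma diam_ball_gt0 (y : X) (t : R) : 0 < t -> 0 < diam (ball y t).
Proof.
move=> t0; rewrite lt_neqAle diam_ge0 andbT; apply/eqP => diam0.
have [C C0 reg] := ahlfors_truncated y.
have /andP[lo _] := reg y t t0.
have : (hausdorff_measure g (ball y t) <= 0)%E.
  apply: hausdorff_measure_le => e e0.
  apply: le_trans (@hausdorff_content_le _ _ g y _ nat [set 0%N]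
    (fun=> y) (fun=> t) _ _ _ _ _) _.
  - exact: countableP.
  - by [].
  - by move=> p yp; exists 0%N.
  - by move=> _ _; rewrite -diam0 lee_fin ltW.
  - by rewrite esum1// => _ _; rewrite -diam0; have [_ _ _ ->] := g_dim.
apply/negP; rewrite -ltNge; apply: lt_le_trans lo.
by rewrite lte_fin mulr_gt0 ?invr_gt0// truncated_gt0.
Qed.

End ahlfors.

Lemma content_ball_le (R : realType) (X : metricType R) (f : R -> R) (z : X)
    (t : R) : 0 < t ->
  (0 <= f (diam (ball z t))) ->
  (hausdorff_content f +oo (ball z t) <= (f (diam (ball z t)))%:E)%E.
Proof.
move=> t0 f0.
apply: le_trans (@hausdorff_content_le _ _ f z _ nat [set 0%N]
  (fun=> z) (fun=> t) _ _ _ _ _) _.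
- exact: countableP.
- by [].
- by move=> p yp; exists 0%N.
- by move=> _ _; rewrite leey.
- by rewrite esum_set1.
Qed.

Theorem theorem2p6 (R : realType) (X : metricType R) (f g : R -> R)
    (x : nat -> X) (r : nat -> R) (E : nat -> set X) (c : R)
    (X_compact : compact [set: X])
    (g_dim : dimension_function g)
    (g_doubling : doubling g)
    (g_regular : ahlfors_regular X g)
    (f_dim : dimension_function f)
    (f_preceq_g : dim_preceq f g)
    (r_gt0 : forall n, 0 < r n)
    (r_cvg0 : r n @[n --> \oo] --> 0)
    (B_full : hausdorff_measure g (lim_sup_set (fun n => ball (x n) (r n))) =
              hausdorff_measure g [set: X])
    (E_open : forall n, open (E n))
    (E_sub : forall n, E n `<=` ball (x n) (r n))
    (c_gt0 : 0 < c)
    (E_content : forall n,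
       (c%:E * hausdorff_measure g (ball (x n) (r n)) <
          hausdorff_content f +oo (E n))%E) :
  large_intersection_class f (lim_sup_set E).
Proof.
have [_ _ f_ge0 f00] := f_dim; have [_ _ g_ge0 _] := g_dim.
have g_gt0 := doubling_gt0 g_dim g_doubling.
have d_gt0 : 0 < diam [set: X].
  rewrite lt_neqAle diam_ge0 andbT; apply/eqP => d0.
  have := E_content 0%N; apply/negP; rewrite -leNgt.
  apply: (@le_trans _ _ 0%E); last first.
    by rewrite mule_ge0 ?lee_fin ?hausdorff_measure_ge0// ltW.
  apply: le_trans (hausdorff_content_subset f _ (E_sub 0%N)) _.
  have diam0 : diam (ball (x 0%N) (r 0%N)) = 0.
    by apply/eqP; rewrite eq_le diam_ge0 d0 andbT diam_ball_le_diam.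
  by have := @content_ball_le _ X f (x 0%N) _ (r_gt0 0%N); rewrite diam0 f00; apply.
have [C C_gt0 reg] := ahlfors_truncated X_compact g_dim g_doubling g_regular d_gt0 (x 0%N).
have measure_ge y t : 0 < t -> _ := fun t0 => proj1 (andP (reg y t t0)).
have measure_le y t : 0 < t -> _ := fun t0 => proj2 (andP (reg y t t0)).
have Hfin := hausdorff_measure_setT_fin X_compact g_dim g_regular d_gt0 (x 0%N).
have [f_gt0 [K K1 fg]] := preceq_quasi_decreasing f_dim g_gt0 f_preceq_g d_gt0.
have K_gt0 : 0 < K by lra.
have [Dg Dg1 g_dbl] := g_doubling.
pose D := K * Dg.
have Dg_gt0 : 0 < Dg by lra.
have D_gt0 : 0 < D by rewrite mulr_gt0.
have F_gt0 := truncated_gt0 d_gt0 f_gt0.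
have G_gt0 := truncated_gt0 d_gt0 g_gt0.
have F_mono := truncated_mono d_gt0 f_dim.
have FG := truncated_quasi_decreasing d_gt0 fg.
have G_dbl' := truncated_doubling d_gt0 g_dim Dg1 g_dbl.
have G_dbl t : 0 < t -> truncated X g (2 * t) <= D * truncated X g t.
  move=> t0; apply: (le_trans (G_dbl' _ t0)).
  by rewrite ler_pM2r ?G_gt0// ler_peMl// ltW.
have F_dbl t : 0 < t -> truncated X f (2 * t) <= D * truncated X f t.
  move=> t0; have t2 : t <= 2 * t by lra.
  rewrite -(ler_pM2r (G_gt0 _ t0)); apply: (le_trans (FG _ _ t0 t2)).
  rewrite /D -!mulrA ler_pM2l// mulrCA ler_pM2l ?F_gt0//.
  by rewrite (le_trans (G_dbl' _ t0)).
clearbody D.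
have [kappa kappa_gt0 fill] := filling g_ge0 G_gt0 G_dbl C_gt0 D_gt0
  measure_ge measure_le Hfin r_gt0 r_cvg0 B_full.
have pack (s : seq nat) (z : X) (t : R) : 0 < t -> uniq s ->
    trivIset [set` s] (fun n => ball (x n) (r n)) ->
    (forall n, n \in s -> ball (x n) (r n) `<=` ball z t) ->
    \sum_(n <- s) truncated X g (r n) <= C ^+ 2 * D ^+ 2 * truncated X g t.
  by move=> t0 us triv sub; exact: (packing g_ge0 G_dbl C_gt0 D_gt0
    measure_ge measure_le t0 us (fun n _ => r_gt0 n) triv sub).
set C1 := C ^+ 2 * D ^+ 2 in pack.
have C1_gt0 : 0 < C1 by rewrite mulr_gt0 ?exprn_gt0.
pose eps := Num.min (1 / 2) (kappa / 2 / (C1 * D ^+ 2 * K)).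
have CDK : 0 < C1 * D ^+ 2 * K by rewrite !mulr_gt0 ?exprn_gt0.
have eps_gt0 : 0 < eps by rewrite lt_min !divr_gt0.
have eps_lt1 : eps < 1 by rewrite gt_min; apply/orP; left; lra.
have eps_small : C1 * D ^+ 2 * K * eps <= kappa / 2.
  by rewrite mulrC -ler_pdivlMr// ge_min lexx orbT.
have E_content' n : ((c * C^-1 * truncated X g (r n))%:E <=
    hausdorff_content f +oo (E n))%E.
  apply: le_trans (ltW (E_content n)).
  rewrite -mulrA EFinM; apply: lee_wpmul2l; first by rewrite lee_fin ltW.
  exact: measure_ge.
have cC_gt0 : 0 < c * C^-1 by rewrite divr_gt0.
have F_diam (y : X) (t : R) : 0 < t -> f (diam (ball y t)) <= truncated X f (2 * t).
  by move=> t0; exact: (truncated_diam_ball X_compact y f_dim t0).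
split.
  exists (fun n => \bigcup_(j >= n) E j) => // n.
  exact: bigcup_open.
exists (eps / (2 * D ^+ 2)); first by rewrite divr_gt0 ?mulr_gt0 ?exprn_gt0.
move=> z t t0; rewrite ltNge; apply/negP => small.
have Ft := F_gt0 _ t0.
have : (hausdorff_content f +oo (lim_sup_set E `&` ball z t) <
    (eps / D * truncated X f t)%:E)%E.
  apply: (le_lt_trans small).
  apply: (@le_lt_trans _ _ ((eps / (2 * D ^+ 2))%:E * (D * truncated X f t)%:E)%E).
    apply: lee_wpmul2l; first by rewrite lee_fin divr_ge0 ?mulr_ge0 ?exprn_ge0// ltW.
    apply: (le_trans (@content_ball_le _ X f z t t0 _)).
      by apply: f_ge0; exact: diam_ge0.
    by rewrite lee_fin (le_trans (F_diam z t t0)) ?F_dbl.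
  have eDF : 0 < eps / D * truncated X f t by rewrite mulr_gt0 ?divr_gt0.
  rewrite -EFinM lte_fin expr2 !invfM -!mulrA mulKf ?gt_eqF//.
  by move: eDF; rewrite -mulrA mulrCA; lra.
move=> /ereal_inf_lt[_ [I [y [s [s0 cov _ ->]]]] sum_lt].
have dy i : I i -> 0 < diam (ball (y i) (s i)).
  by move=> /s0; exact: (diam_ball_gt0 X_compact g_dim g_doubling g_regular d_gt0).
pose rad i := 2 * diam (ball (y i) (s i)).
have rad_gt0 i : I i -> 0 < rad i by move=> /dy di; rewrite mulr_gt0.
have sum_le : (\esum_(i in I) (truncated X f (rad i))%:E <=
    (eps * truncated X f t)%:E)%E.
  apply: (@le_trans _ _ (\esum_(i in I) (D%:E * (f (diam (ball (y i) (s i))))%:E))%E).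
    apply: le_esum => i Ii; rewrite -EFinM lee_fin.
    apply: (le_trans (F_dbl _ (dy _ Ii))); rewrite ler_pM2l//.
    by rewrite /truncated min_l// diam_ball_le_diam// s0.
  apply: (le_trans (le_esumZl (ltW D_gt0) _)) => [i Ii|].
    by rewrite lee_fin f_ge0// ltW// dy.
  apply: (@le_trans _ _ (D%:E * (eps / D * truncated X f t)%:E)%E).
    by apply: lee_wpmul2l; rewrite ?lee_fin ltW.
  by rewrite -EFinM lee_fin mulrA (mulrCA D) divff ?mulr1// gt_eqF.
have sum_fin : (\esum_(i in I) (truncated X f (rad i))%:E < +oo)%E.
  by apply: le_lt_trans sum_le _; rewrite ltry.
have [p [Ep zp nup]] : exists p, [/\ lim_sup_set E p, ball z t p &
    forall i, I i -> ~ ball (y i) (rad i) p].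
  apply: (uncovered_point f_ge0 F_gt0 F_mono F_dbl D_gt0 F_diam G_gt0 G_dbl FG
    r_gt0 r_cvg0 pack fill E_open E_sub E_content' cC_gt0 kappa_gt0 K_gt0 C1_gt0
    eps_gt0 eps_lt1 eps_small rad_gt0 sum_fin (truncated_small d_gt0 f_dim) X_compact).
  split => //; apply: le_trans sum_le.
  by apply: esum_subset => i [].
have [i Ii ip] := cov p (conj Ep zp).
apply: (nup i Ii); apply/ball_mdist; rewrite /rad.
have : mdist (y i) p <= diam (ball (y i) (s i)).
  by apply: mdist_le_diam_ball => //; apply: ballxx; exact: s0.
by have := dy _ Ii; lra.
Qed.
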